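(* Let $\mathcal{K}\subset E$ be a closed convex cone, let $c\in E$ be nonzero and such that there exists $x\in\mathcal{K}$ with $\langle c,x\rangle>0$, and let $\rho:E\to\mathbb{R}$ be a convex quartic form with $\alpha^2\|x\|^4\le\rho(x)\le\beta^2\|x\|^4$ for all $x\in E$, where $0<\alpha\le\beta$. Let $f(x)=\rho(x)-\langle c,x\rangle$, and for $y\ne0$ let $$s(y)=\operatorname*{argmin}_{s\ge0}f(sy)=\left(\frac{\max(\langle c,y\rangle,0)}{4\rho(y)}\right)^{1/3}.$$ Let $y^*$ be a minimizer of $\sqrt{\rho(y)}$ over the set $\{y\in\mathcal{K}:\langle c,y\rangle=1\}$. Then: (i) $x^*=s(y^* )\,y^*$ is a minimizer of $f$ over $\mathcal{K}$; (ii) for any $y\in\mathcal{K}$ such that $\langle c,y\rangle=1$, the point $x=s(y)\,y$ satisfies $$\frac{f(x)-f(x^* )}{|f(x^* )|}\ \le\ \frac23\,\frac{\sqrt{\rho(y)}-\sqrt{\rho(y^* )}}{\sqrt{\rho(y^* )}}.$$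
   Context: $E$ is a finite-dimensional Euclidean space with canonical inner product $\langle\cdot,\cdot\rangle$, and $\|\cdot\|$ is a Euclidean norm on $E$. A convex quartic form is a convex function $\rho$ of the form $\rho(x)=Q[x,x,x,x]$, where $Q:E^4\to\mathbb{R}$ is $4$-linear and symmetric (invariant under permutations of its arguments). *)

(* Defs.v *)
From HB Require Import structures.
From mathcomp Require Import all_boot all_order all_fingroup all_algebra.
From mathcomp Require Import all_classical all_reals all_analysis.

Set Implicit Arguments.
Unset Strict Implicit.
Unset Printing Implicit Defensive.

Import Order.TTheory GRing.Theory Num.Theory.
Import numFieldNormedType.Exports.

Local Open Scope classical_set_scope.
Local Open Scope ring_scope.

(* A finite-dimensional space carries a single vector-space topology, so the
   library's [closed], which refers to the norm `|.|, does not depend on the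
   choice of that norm. *)
#[short(type="finNormedModType")]
HB.structure Definition FinNormedModule (R : numFieldType) :=
  {E of NormedModule R E & Vector R E}.

Definition euclidean_norm (R : realType) (E : lmodType R) (N : E -> R) : Prop :=
  exists B : {dot E for idfun}, forall x : E, N x = Num.sqrt (B x x).

Definition cone (R : realType) (E : lmodType R) (K : set E) : Prop :=
  forall (t : R) (x : E), 0 <= t -> K x -> K (t *: x).

(* [E ^ n] is [{ffun 'I_n -> E}]. *)
Definition multilinear (R : realType) (E : lmodType R) (n : nat)
    (Q : E ^ n -> R) : Prop :=
  forall (i : 'I_n) (v : E ^ n),
    scalar (fun x : E => Q [ffun j => if j == i then x else v j]).

Definition symmetric_map (R : realType) (E : lmodType R) (n : nat)
    (Q : E ^ n -> R) : Prop :=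
  forall (s : 'S_n) (v : E ^ n), Q [ffun i => v (s i)] = Q v.

Definition convex_quartic_form (R : realType) (E : lmodType R)
    (rho : E -> R) : Prop :=
  @convex_function R E setT rho /\
  exists Q : E ^ 4 -> R, [/\ multilinear Q, symmetric_map Q &
    forall x : E, rho x = Q [ffun=> x]].

Definition argmin (R : realType) (T : Type) (A : set T) (f : T -> R) : set T :=
  [set x | A x /\ forall y, A y -> f x <= f y].

(* Main.v *)
(* Along the ray through [y] with [<c, y> = 1], stationarity [4 rho(y) s^3 = 1]
   gives [f (s y) = - 3/4 s(y)], so minimizing [f] over the rays of [K] amounts
   to minimizing [rho]. The relative gap is [1 - q] with [q = s(y) / s(ystar)],
   where [q^3 r^2 = 1] for [r = sqrt (rho y) / sqrt (rho ystar)]. *)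

Require Import Defs.
From mathcomp Require Import all_boot all_order all_algebra ring lra.
From mathcomp Require Import all_classical all_reals all_analysis.

Set Implicit Arguments.
Unset Strict Implicit.
Unset Printing Implicit Defensive.

Import Order.TTheory GRing.Theory Num.Theory.
Import numFieldNormedType.Exports.

Local Open Scope classical_set_scope.
Local Open Scope ring_scope.

(** The factors [t] come out one slot at a time, by induction on the number [k] of slots already
    scaled. *)
Lemma multilinear_scale (R : realType) (E : lmodType R) (n : nat)
    (Q : E ^ n -> R) (t : R) (v : E ^ n) :
  multilinear Q -> Q [ffun i => t *: v i] = t ^+ n * Q v.
Proof.
move=> Qlin.
have step k : (k <= n)%N ->
    Q [ffun i : 'I_n => if (i < k)%N then t *: v i else v i] = t ^+ k * Q v.
  elim: k => [_|k IH ltkn].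
    by rewrite mul1r; congr Q; apply/ffunP => i; rewrite ffunE.
  pose w : E ^ n := [ffun i : 'I_n => if (i < k)%N then t *: v i else v i].
  pose i0 := Ordinal ltkn.
  (* Slot [k] is isolated with the others frozen at [w]: [g (t *: v i0)] is stage [k.+1] and
     [g (v i0)] is stage [k]. *)
  pose g (x : E) := Q [ffun j => if j == i0 then x else w j].
  have gP : scalar g := Qlin i0 w.
  have g0 : g 0 = 0.
    have := gP 1 0 0; rewrite scale1r addr0 mul1r => /esym/eqP.
    by rewrite -subr_eq0 addrK => /eqP.
  have -> : Q [ffun i : 'I_n => if (i < k.+1)%N then t *: v i else v i]
      = g (t *: v i0).
    congr Q; apply/ffunP => i; rewrite !ffunE ltnS leq_eqVlt -(inj_eq val_inj)/=.
    by case: eqP => [ik|//]; rewrite (_ : i = i0)//; exact: val_inj.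
  have gw : g (v i0) = t ^+ k * Q v.
    rewrite -IH ?(ltnW ltkn)//; congr Q; apply/ffunP => i; rewrite !ffunE.
    by case: eqVneq => [->|//]; rewrite /= ltnn.
  by have := gP t (v i0) 0; rewrite addr0 g0 addr0 gw exprS mulrA.
rewrite -(step n)//; congr Q; apply/ffunP => i.
by rewrite !ffunE ltn_ord.
Qed.

Lemma quartic_form_scale (R : realType) (E : lmodType R) (rho : E -> R)
    (t : R) (x : E) :
  convex_quartic_form rho -> rho (t *: x) = t ^+ 4 * rho x.
Proof.
move=> [_ [Q [Qlin _ rhoE]]]; rewrite !rhoE -multilinear_scale//.
by congr Q; apply/ffunP => i; rewrite !ffunE.
Qed.

(** For [b >= 0] this is the vanishing of the derivative of [t ^+ 4 * a - t * b] at the closed form;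
    for [b < 0] it forces that point to be 0. *)
Lemma ray_minimizer_stationary (R : realType) (a b : R) : 0 < a ->
  4 * a * ((Num.max b 0 / (4 * a)) `^ (1 / 3)) ^+ 3 = Num.max b 0.
Proof.
move=> a_gt0; rewrite -powR_mulrn ?powR_ge0// -powRrM mul1r mulVf// powRr1; last first.
  by rewrite divr_ge0 ?mulr_ge0 ?(ltW a_gt0)// le_max lexx orbT.
by rewrite mulrC divfK// mulf_neq0 ?gt_eqF.
Qed.

Lemma ray_argmin (R : realType) (a b : R) : 0 < a ->
  argmin [set t : R | 0 <= t] (fun t => t ^+ 4 * a - t * b) =
  [set (Num.max b 0 / (4 * a)) `^ (1 / 3)].
Proof.
move=> a_gt0; have := ray_minimizer_stationary b a_gt0.
set t0 := _ `^ _ => t0E; have t0_ge0 : 0 <= t0 by exact: powR_ge0.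
(* Taylor expansion at [t0] leaves [a * (t - t0) ^+ 2 * (t ^+ 2 + 2 * t * t0 + 3 * t0 ^+ 2)] beyond
   the first-order term; the nonnegative part [2 * t * t0 + t0 ^+ 2] is dropped. *)
have gap t : 0 <= t -> a * (t - t0) ^+ 2 * (t ^+ 2 + 2 * t0 ^+ 2)
    <= (t ^+ 4 * a - t * b) - (t0 ^+ 4 * a - t0 * b).
  move=> t_ge0.
  (* First-order condition on the half-line: either [b <= 0] and [t0] is the endpoint 0, or the
     derivative vanishes at [t0]. *)
  have slack : 0 <= (4 * a * t0 ^+ 3 - b) * (t - t0).
    move: (t0E); rewrite maxEle; case: ifP => b0 E0.
      have t00 : t0 = 0.
        move/eqP: E0; rewrite mulf_eq0 expf_eq0/= mulf_eq0 (gt_eqF a_gt0).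
        rewrite pnatr_eq0/=.
        by move/eqP.
      by rewrite E0 t00 sub0r subr0 mulr_ge0// oppr_ge0.
    by rewrite E0 subrr mul0r.
  rewrite -subr_ge0.
  have -> : t ^+ 4 * a - t * b - (t0 ^+ 4 * a - t0 * b)
      - a * (t - t0) ^+ 2 * (t ^+ 2 + 2 * t0 ^+ 2)
      = (4 * a * t0 ^+ 3 - b) * (t - t0)
        + a * (t - t0) ^+ 2 * (2 * t * t0 + t0 ^+ 2) by ring.
  apply: addr_ge0 => //; apply: mulr_ge0.
    by rewrite mulr_ge0 ?sqr_ge0 ?ltW.
  by rewrite addr_ge0 ?sqr_ge0// mulr_ge0// mulr_ge0.
have pos t : 0 <= a * (t - t0) ^+ 2 * (t ^+ 2 + 2 * t0 ^+ 2).
  apply: mulr_ge0; first by rewrite mulr_ge0 ?sqr_ge0 ?ltW.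
  by rewrite addr_ge0 ?sqr_ge0// mulr_ge0 ?sqr_ge0.
apply/seteqP; split => t /=; last first.
  move=> ->; split => // u u_ge0; rewrite -subr_ge0.
  exact: le_trans (pos u) (gap u u_ge0).
move=> [t_ge0 /(_ _ t0_ge0)]; rewrite -subr_le0 => /(le_trans (gap t t_ge0)) le0.
have /eqP : a * (t - t0) ^+ 2 * (t ^+ 2 + 2 * t0 ^+ 2) = 0.
  by apply/eqP; rewrite eq_le le0 pos.
rewrite mulf_eq0 mulf_eq0 (gt_eqF a_gt0)/= sqrf_eq0 subr_eq0 => /orP[/eqP//|].
(* The other factor vanishes only if [t] and [t0] are both 0, so again [t = t0]. *)
rewrite paddr_eq0 ?sqr_ge0 ?mulr_ge0 ?sqr_ge0// sqrf_eq0 mulf_eq0 pnatr_eq0/= sqrf_eq0.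
by move=> /andP[/eqP-> /eqP->].
Qed.

(* AM-GM gives [q ^ 3 (5 - 3 q) ^ 2 <= 4 = q ^ 3 (2 r) ^ 2]. *)
Lemma cube_ratio_bound (R : realFieldType) (q r : R) :
  0 < q -> q <= 1 -> 0 < r -> q ^+ 3 * r ^+ 2 = 1 -> 1 - q <= 2 / 3 * (r - 1).
Proof.
(* The goal is equivalent to [5 - 3 * q <= 2 * r]; squaring the reverse strict inequality
   contradicts [amgm]. *)
move=> q_gt0 q_le1 r_gt0 qr; case: (leP (5 - 3 * q) (2 * r)) => [|lt_r]; first lra.
have amgm : q ^+ 3 * (5 - 3 * q) ^+ 2 <= 4.
  rewrite -subr_ge0.
  (* The equality case [q = 1] is a double root; the cofactor is grouped so that [q <= 1] makes its
     last term nonnegative. *)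
  have -> : 4 - q ^+ 3 * (5 - 3 * q) ^+ 2
      = (1 - q) ^+ 2 * (4 + 8 * q + 3 * q ^+ 2 + 9 * (q ^+ 2 * (1 - q))) by ring.
  rewrite mulr_ge0 ?sqr_ge0//.
  have : 0 <= q ^+ 2 * (1 - q) by rewrite mulr_ge0 ?sqr_ge0 ?subr_ge0.
  by have := sqr_ge0 q; lra.
have : q ^+ 3 * (2 * r) ^+ 2 < q ^+ 3 * (5 - 3 * q) ^+ 2.
  by rewrite ltr_pM2l ?exprn_gt0// ltr_pXn2r ?nnegrE//; lra.
by rewrite exprMn mulrCA qr => /lt_le_trans/(_ amgm); lra.
Qed.

Theorem proposition4p2 (R : realType) (E : finNormedModType R)
    (ip : {dot E for idfun})
    (norm_euclidean : euclidean_norm (fun x : E => `|x|))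
    (K : set E) (K_closed : closed K) (K_convex : @convex_set R E K)
    (K_cone : cone K)
    (c : E) (c_neq0 : c != 0) (K_c : exists2 x : E, K x & 0 < ip c x)
    (rho : E -> R) (rho_quartic : convex_quartic_form rho)
    (alpha beta : R) (alpha_gt0 : 0 < alpha) (alpha_le_beta : alpha <= beta)
    (rho_bounds : forall x : E,
       alpha ^+ 2 * `|x| ^+ 4 <= rho x <= beta ^+ 2 * `|x| ^+ 4) :
  let f := fun x : E => rho x - ip c x in
  let S := fun y : E => argmin [set t : R | 0 <= t] (fun t => f (t *: y)) in
  let s := fun y : E => get (S y) in
  (forall y : E, y != 0 ->
     S y = [set (Num.max (ip c y) 0 / (4 * rho y)) `^ (1 / 3)]) /\
  forall ystar : E,
    argmin [set y : E | K y /\ ip c y = 1] (fun y => Num.sqrt (rho y)) ystar ->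
    let xstar := s ystar *: ystar in
    argmin K f xstar /\
    (forall y : E, K y -> ip c y = 1 ->
       let x := s y *: y in
       (f x - f xstar) / `|f xstar| <=
       2 / 3 * ((Num.sqrt (rho y) - Num.sqrt (rho ystar))
                / Num.sqrt (rho ystar))).
Proof.
move=> f S s.
have ipZ t y : ip c (t *: y) = t * ip c y by rewrite linearZr.
have rhoZ t y : rho (t *: y) = t ^+ 4 * rho y := quartic_form_scale t y rho_quartic.
have fZ t y : f (t *: y) = t ^+ 4 * rho y - t * ip c y by rewrite /f ipZ rhoZ.
have rho_ge0 y : 0 <= rho y.
  have /andP[+ _] := rho_bounds y; apply: le_trans.
  by rewrite mulr_ge0 ?exprn_ge0 ?(ltW alpha_gt0).
have rho_gt0 y : y != 0 -> 0 < rho y.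
  move=> y0; have /andP[+ _] := rho_bounds y; apply: lt_le_trans.
  by rewrite mulr_gt0 ?exprn_gt0 ?normr_gt0.
have SE y : y != 0 -> S y = [set (Num.max (ip c y) 0 / (4 * rho y)) `^ (1 / 3)].
  move=> y0; rewrite -ray_argmin ?rho_gt0//; congr argmin.
  by apply/funext => t; exact: fZ.
split=> // ystar [[Kys cys] ysmin] xstar.
have nz y : ip c y = 1 -> y != 0.
  by move=> cy; apply/eqP => y0; move: cy; rewrite y0 linear0r => /esym/eqP; rewrite oner_eq0.
have sP y : ip c y = 1 -> [/\ 0 < s y, 4 * rho y * s y ^+ 3 = 1,
    f (s y *: y) = - (3 / 4 * s y) & forall t, 0 <= t -> f (s y *: y) <= f (t *: y)].
  move=> cy; have y0 := nz _ cy; have ry := rho_gt0 _ y0.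
  (* [get] returns an actual minimizer because [SE] shows the argmin set to be inhabited. *)
  have Ssy : S y (s y) by apply: getPex; eexists; rewrite SE.
  have sE : s y = (Num.max (ip c y) 0 / (4 * rho y)) `^ (1 / 3).
    by move: (Ssy); rewrite SE.
  have s3 : 4 * rho y * s y ^+ 3 = 1.
    by rewrite sE ray_minimizer_stationary// cy max_l.
  have [s_ge0 smin] := Ssy.
  split=> //.
    rewrite lt_neqAle s_ge0 andbT eq_sym; apply/eqP => s0.
    by move: s3; rewrite s0 expr0n mulr0 => /esym/eqP; rewrite oner_eq0.
  rewrite fZ cy mulr1 exprS.
  have -> : s y * s y ^+ 3 * rho y = s y / 4 * (4 * rho y * s y ^+ 3) by field.
  by rewrite s3; field.
have rho_min y : K y -> ip c y = 1 -> rho ystar <= rho y.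
  by move=> Ky cy; rewrite -ler_sqrt ?rho_ge0//; exact: ysmin.
have [ss_gt0 ss3 fss ssmin] := sP _ cys.
split; first split.
- by apply: K_cone => //; exact: ltW.
- move=> z Kz; have [cz|cz] := leP (ip c z) 0.
    rewrite fss; apply: (@le_trans _ _ 0).
      by rewrite oppr_le0 mulr_ge0 ?ltW.
    by rewrite subr_ge0 (le_trans cz).
  (* Scaling [ystar] by [ip c z] matches the linear term of [f z], so only the values of [rho]
     remain to be compared, on the slice [ip c _ = 1]. *)
  apply: (le_trans (ssmin _ (ltW cz))); rewrite fZ cys mulr1 /f lerD2r.
  have -> : rho z = ip c z ^+ 4 * rho ((ip c z)^-1 *: z).
    by rewrite -rhoZ scalerA divff ?scale1r ?gt_eqF.
  rewrite ler_pM2l ?exprn_gt0//; apply: rho_min.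
    by apply: K_cone => //; rewrite invr_ge0 ltW.
  by rewrite ipZ mulVf// gt_eqF.
move=> y Ky cy; cbv zeta.
have [sy_gt0 sy3 fsy _] := sP _ cy.
have rs_gt0 : 0 < rho ystar by rewrite rho_gt0 ?nz.
have ry_gt0 : 0 < rho y by rewrite rho_gt0 ?nz.
have qs_gt0 : 0 < Num.sqrt (rho ystar) by rewrite sqrtr_gt0.
have qy_gt0 : 0 < Num.sqrt (rho y) by rewrite sqrtr_gt0.
rewrite /xstar fss fsy normrN gtr0_norm ?mulr_gt0//.
have -> : (- (3 / 4 * s y) - - (3 / 4 * s ystar)) / (3 / 4 * s ystar)
    = 1 - s y / s ystar by field; rewrite gt_eqF.
rewrite mulrBl divff ?gt_eqF//.
have ratio : (s y / s ystar) ^+ 3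
    * (Num.sqrt (rho y) / Num.sqrt (rho ystar)) ^+ 2 = 1.
  rewrite !expr_div_n !sqr_sqrtr//.
  have -> : s y ^+ 3 / s ystar ^+ 3 * (rho y / rho ystar)
    = (4 * rho y * s y ^+ 3) / (4 * rho ystar * s ystar ^+ 3).
    by field; rewrite !gt_eqF.
  by rewrite sy3 ss3 divff ?oner_eq0.
apply: cube_ratio_bound => //; rewrite ?divr_gt0//.
(* [q <= 1]: both products [4 * rho * s ^+ 3] equal 1, so the smaller [rho ystar] goes with the
   larger [s ystar]. *)
rewrite ler_pdivrMr// mul1r -(@ler_pXn2r _ 3) ?nnegrE ?(ltW sy_gt0) ?(ltW ss_gt0)//.
have ry4_gt0 : 0 < 4 * rho y by rewrite mulr_gt0.
rewrite -(ler_pM2l ry4_gt0).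
apply: (@le_trans _ _ (4 * rho ystar * s ystar ^+ 3)); first by rewrite sy3 ss3.
by rewrite ler_pM2r ?exprn_gt0// ler_pM2l// rho_min.
Qed.
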